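(* For all real numbers $a, b>0$, $$L(a,b) \leq \left( \frac{a^{1/3}+b^{1/3}}{2}\right)^3 \leq \frac{2}{3}\sqrt{ab}+ \frac{1}{3}\cdot\frac{a+b}{2}.$$
   Context: For positive real numbers $a,b$, $L(a,b)$ denotes the logarithmic mean: $L(a,b) = \frac{a-b}{\log a-\log b} = \int_0^1 a^{\nu} b^{1-\nu}\, d\nu$ if $a\neq b$, and $L(a,b)=a$ if $a=b$. *)

(* Defs.v *)
From Stdlib Require Import Reals.
Open Scope R_scope.

(** Logarithmic mean, meant for [0 < a] and [0 < b]: Stdlib's [ln] is [0] on
    nonpositive arguments. *)
Definition log_mean (a b : R) : R :=
  if Req_dec_T a b then a else (a - b) / (ln a - ln b).

(* Main.v *)
(** Put [a = u ^ 3] and [b = v ^ 3] with [t = u / v > 1]: the first inequality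
    becomes [ln t >= 8 (t ^ 3 - 1) / (3 (t + 1) ^ 3)], an equality at [t = 1]
    where the difference of the two sides has derivative
    [(t - 1) ^ 4 / (t (t + 1) ^ 4)]. With [a = x ^ 6] and [b = y ^ 6] the second
    one is [(x - y) ^ 4 (x ^ 2 + 4 x y + y ^ 2) >= 0]. *)
Require Import Defs.
From Stdlib Require Import Reals Lra.
From Coquelicot Require Import Coquelicot.
Open Scope R_scope.

Lemma ln_ge_rational (t : R) : 1 < t -> 8 * (t ^ 3 - 1) / (3 * (t + 1) ^ 3) <= ln t.
Proof.
intros ht.
set (f := fun x => ln x - 8 * (x ^ 3 - 1) / (3 * (x + 1) ^ 3)).
(* Some [c] in (1, t) makes [f t - f 1] the derivative at [c] times [t - 1], both nonnegative. *)
destruct (MVT_cor2 f (fun x => (x - 1) ^ 4 / (x * (x + 1) ^ 4)) 1 t ht)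
  as [c [Hf Hc]].
- intros x Hx. apply is_derive_Reals. unfold f.
  assert (0 < (x + 1) ^ 3) by (apply pow_lt; lra).
  auto_derive.
  + repeat split; simpl in *; lra.
  + field. lra.
- assert (f1 : f 1 = 0) by (unfold f; rewrite ln_1; field).
  assert (0 <= (c - 1) ^ 4 / (c * (c + 1) ^ 4)).
  { apply Rmult_le_pos.
    - apply pow_le; lra.
    - apply Rlt_le, Rinv_0_lt_compat, Rmult_lt_0_compat;
        [lra | apply pow_lt; lra]. }
  assert (0 <= f t - f 1) by (rewrite Hf; apply Rmult_le_pos; lra).
  unfold f in *; lra.
Qed.

Lemma log_mean_sym (a b : R) : log_mean a b = log_mean b a.
Proof.
unfold log_mean.
destruct (Req_dec_T a b), (Req_dec_T b a); try congruence.
unfold Rdiv.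
rewrite <- (Ropp_minus_distr b a), <- (Ropp_minus_distr (ln b) (ln a)).
rewrite Rinv_opp; ring.
Qed.

Lemma log_mean_cube_le (u v : R) :
  0 < v -> v < u -> log_mean (u ^ 3) (v ^ 3) <= ((u + v) / 2) ^ 3.
Proof.
intros hv huv.
assert (huv3 : v ^ 3 < u ^ 3).
{ assert (0 < (u - v) * (u ^ 2 + u * v + v ^ 2))
    by (apply Rmult_lt_0_compat; nra).
  lra. }
assert (ht : 1 < u / v) by (apply Rlt_div_r; lra).
pose proof (ln_ge_rational (u / v) ht) as Hln.
rewrite ln_div in Hln by lra.
(* Numerator and denominator are both scaled by [v ^ 3]. *)
replace (8 * ((u / v) ^ 3 - 1) / (3 * (u / v + 1) ^ 3))
  with (8 * (u ^ 3 - v ^ 3) / (3 * (u + v) ^ 3)) in Hln by (field; lra).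
assert (Hlt : ln v < ln u) by (apply ln_increasing; lra).
unfold log_mean; destruct (Req_dec_T (u ^ 3) (v ^ 3)) as [|_]; [lra|].
rewrite !ln_pow by lra.
assert (hp : 0 < (u + v) ^ 3) by (apply pow_lt; lra).
apply Rle_div_l; [simpl; lra|].
apply Rle_div_l in Hln; [|lra].
(* The factor 3 from the logarithms of cubes matches the 3 in [Hln], so the goal is [Hln] divided by
   8. *)
replace (((u + v) / 2) ^ 3) with ((u + v) ^ 3 / 8) by field.
simpl INR; nra.
Qed.

Lemma Rpower_third_cube (a : R) : 0 < a -> Rpower a (1 / 3) ^ 3 = a.
Proof.
intros ha.
rewrite <- Rpower_pow by apply exp_pos.
rewrite Rpower_mult.
replace (1 / 3 * INR 3) with 1 by (simpl; field).
now apply Rpower_1.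
Qed.

(** Both sides are symmetric, which reduces to [v < u]; on the diagonal both equal [v ^ 3]. *)
Lemma log_mean_le_power_mean (u v : R) :
  0 < u -> 0 < v -> log_mean (u ^ 3) (v ^ 3) <= ((u + v) / 2) ^ 3.
Proof.
intros hu hv.
destruct (Rtotal_order u v) as [h | [-> | h]].
- rewrite log_mean_sym, (Rplus_comm u v). now apply log_mean_cube_le.
- unfold log_mean; destruct (Req_dec_T (v ^ 3) (v ^ 3)) as [_ | n]; [|now elim n].
  replace ((v + v) / 2) with v by field. lra.
- now apply log_mean_cube_le.
Qed.

Lemma power_mean_le_heron (u v : R) :
  0 < u -> 0 < v ->
  ((u + v) / 2) ^ 3
    <= 2 / 3 * sqrt (u ^ 3 * v ^ 3) + 1 / 3 * ((u ^ 3 + v ^ 3) / 2).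
Proof.
intros hu hv.
(* In terms of [x] and [y] the square root becomes the polynomial [x ^ 3 * y ^ 3]. *)
set (x := sqrt u); set (y := sqrt v).
assert (hx : 0 < x) by now apply sqrt_lt_R0.
assert (hy : 0 < y) by now apply sqrt_lt_R0.
replace u with (x ^ 2) by (apply pow2_sqrt; lra).
replace v with (y ^ 2) by (apply pow2_sqrt; lra).
clearbody x y.
replace ((x ^ 2) ^ 3 * (y ^ 2) ^ 3) with ((x ^ 3 * y ^ 3) ^ 2) by ring.
rewrite sqrt_pow2 by (apply Rmult_le_pos; apply pow_le; lra).
(* This product is 24 times the right side minus the left. *)
assert (0 <= ((x - y) ^ 2) ^ 2 * (x ^ 2 + 4 * x * y + y ^ 2)).
{ apply Rmult_le_pos; [apply pow2_ge_0 | nra]. }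
lra.
Qed.

Theorem lemma1p1 (a b : R) (ha : 0 < a) (hb : 0 < b) :
  log_mean a b <= ((Rpower a (1 / 3) + Rpower b (1 / 3)) / 2) ^ 3 /\
  ((Rpower a (1 / 3) + Rpower b (1 / 3)) / 2) ^ 3
    <= 2 / 3 * sqrt (a * b) + 1 / 3 * ((a + b) / 2).
Proof.
(* Occurrences 1, 4 and 5 are those outside [Rpower]; they become cubes, with the cube roots as [u]
   and [v]. *)
rewrite <- (Rpower_third_cube a ha) at 1 4 5.
rewrite <- (Rpower_third_cube b hb) at 1 4 5.
split; [apply log_mean_le_power_mean | apply power_mean_le_heron]; apply exp_pos.
Qed.
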